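(* Let $m,n\ge 2$ be integers, $\mathbb{K}$ a field, $S=\mathbb{K}[x_{i,j}: i\in[m], j\in[n]]$, and $\mathcal{J}_{K_m,P_n}\subseteq S$ the ideal generated by $x_{i,k}x_{j,k+1}-x_{i,k+1}x_{j,k}$ for $1\le i<j\le m$, $k\in[n-1]$. Then for every positive integer $t$, $\mathcal{J}_{K_m,P_n}^{(t)}=\mathcal{J}_{K_m,P_n}^t$.
   Context: For an ideal $I$ of $S$, the $t$-th symbolic power is $I^{(t)}=\bigcap_{\mathfrak p\in\operatorname{Ass}(I)}(I^tS_{\mathfrak p}\cap S)$. *)

(* Defs.v *)
From HB Require Import structures.
From mathcomp Require Import all_boot all_order all_algebra.
From mathcomp Require Import mpoly.
Set Implicit Arguments. Unset Strict Implicit. Unset Printing Implicit Defensive.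
Import GRing.Theory.
Local Open Scope ring_scope.

Section Ideals.
Variable R : comNzRingType.

Definition is_ideal (I : R -> Prop) : Prop :=
  I 0 /\ (forall a b, I a -> I b -> I (a + b)) /\ (forall r a, I a -> I (r * a)).

Definition ideal_gen (G : R -> Prop) : R -> Prop :=
  fun f => exists s : seq (R * R),
    (forall p, p \in s -> G p.2) /\ f = \sum_(p <- s) p.1 * p.2.

Definition ideal_pow (I : R -> Prop) (t : nat) : R -> Prop :=
  ideal_gen (fun g => exists u : seq R,
    size u = t /\ (forall a, a \in u -> I a) /\ g = \prod_(a <- u) a).

Definition is_prime_ideal (P : R -> Prop) : Prop :=
  is_ideal P /\ ~ P 1 /\ (forall a b, P (a * b) -> P a \/ P b).

Definition colon (I : R -> Prop) (f : R) : R -> Prop := fun g => I (g * f).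

Definition Ass (I : R -> Prop) : (R -> Prop) -> Prop :=
  fun P => is_prime_ideal P /\ exists f, forall g, P g <-> colon I f g.

(* Contraction to R of the extension of J to the localization R_P:
   J R_P ∩ R = { f | exists s ∉ P, s f ∈ J }  (R a domain, J an ideal). *)
Definition loc_contract (J P : R -> Prop) : R -> Prop :=
  fun f => exists s, ~ P s /\ J (s * f).

Definition symbolic_pow (I : R -> Prop) (t : nat) : R -> Prop :=
  fun f => forall P, Ass I P -> loc_contract (ideal_pow I t) P f.

End Ideals.

Definition xvar (K : fieldType) (m n : nat) (i : 'I_m) (j : 'I_n) : {mpoly K[m * n]} :=
  'X_(mxvec_index i j).

Definition JKP_gens (K : fieldType) (m n : nat) : {mpoly K[m * n]} -> Prop :=
  fun f => exists (i j : 'I_m) (k k' : 'I_n),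
    (i < j)%N /\ nat_of_ord k' = (nat_of_ord k).+1 /\
    f = @xvar K m n i k * @xvar K m n j k' - @xvar K m n i k' * @xvar K m n j k.

Definition JKP (K : fieldType) (m n : nat) : {mpoly K[m * n]} -> Prop :=
  ideal_gen (@JKP_gens K m n).
Arguments xvar : clear implicits.
Arguments JKP_gens : clear implicits.
Arguments JKP : clear implicits.

(* Main.v *)
From HB Require Import structures.
Require Import Defs.
From mathcomp Require Import all_boot all_order all_algebra.
From mathcomp Require Import mpoly zify ring.
Set Implicit Arguments. Unset Strict Implicit. Unset Printing Implicit Defensive.
Import GRing.Theory.

(* Write [J] for the ideal. For a set [S] of columns that contains neither the
   first nor the last column nor two adjacent ones, let [phi_S] map the matrix of
   variables to a generic matrix which has rank one on each interval of columns
   cut out by [S] and vanishes on [S], plus a matrix of new variables [Y]. The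
   order in [Y] of [phi_S f] is additive on products and at least one on [J], so
   at least [t] on [J^t], and the [f] of positive order form a prime [P_S].

   Key claim: if [phi_S f] has order at least [t] for every [S], then [f] lies in
   [J^t]. Give [x_(i,k)] the weight [(i+1)(k+1)], so that the diagonal term of each
   generator is the heavier one, and let [u] be a monomial of top weight in [f]. If
   [u] is divisible by a product of [t] diagonal terms, subtract the corresponding
   multiple of a product of generators. If not, Koenig's theorem for the bipartite
   graph of diagonal terms yields a minimal vertex cover [C] of [u]-weight less
   than [t]; with [S] the set of columns contained in [C], the coefficient of [u]
   in [f] also occurs in [phi_S f] with [Y]-part [u] restricted to [C], of
   degree less than [t], a contradiction.

   The claim for [t = 1] says that [J] is the intersection of the [P_S], whence
   each [P_S] is of the form [J : g], i.e. associated to [J]. If [f] is in the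
   symbolic power, then [s * f] is in [J^t] for some [s] outside [P_S], so [phi_S f]
   has order at least [t], and the claim applies. *)

(** * Packing edges of bipartite graphs *)

Definition vertex_cover (T : finType) (e : rel T) (C : {set T}) : bool :=
  [forall a, forall b, e a b ==> (a \in C) || (b \in C)].

Lemma vertex_coverP (T : finType) (e : rel T) (C : {set T}) :
  reflect (forall a b, e a b -> (a \in C) || (b \in C)) (vertex_cover e C).
Proof.
apply: (iffP forallP) => [H a b eab|H a].
  by move/forallP/(_ b)/implyP: (H a); apply.
by apply/forallP=> b; apply/implyP; apply: H.
Qed.

(** For vertex covers, meeting on one side of the bipartition and joining on the other gives two
    covers again; this modularity makes both of them tight when [C] and [D] are. *)
Lemma sum_lattice (T : finType) (A : pred T) (u : T -> nat) (C D : {set T}) :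
  \sum_(v in [set v | if A v then (v \in C) && (v \in D)
                      else (v \in C) || (v \in D)]) u v +
  \sum_(v in [set v | if A v then (v \in C) || (v \in D)
                      else (v \in C) && (v \in D)]) u v =
  \sum_(v in C) u v + \sum_(v in D) u v.
Proof.
rewrite !(big_mkcond (fun v => v \in _)) -!big_split /=.
apply: eq_bigr => v _; rewrite !inE.
by case: (A v); case: (v \in C); case: (v \in D) => /=; rewrite ?addn0 // addnC.
Qed.

Lemma sum_sub_indicator (T : finType) (a : T) (u : T -> nat) (C : {set T}) :
  0 < u a ->
  \sum_(v in C) (u v - (v == a)) + (a \in C) = \sum_(v in C) u v.
Proof.
move=> ua; have [aC|aC] := boolP (a \in C); last first.
  rewrite addn0; apply: eq_bigr => v vC.
  by case: eqP => [E|_]; [rewrite E (negbTE aC) in vC | rewrite subn0].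
rewrite (bigD1 a) //= (bigD1 a (F := u)) //= eqxx.
have -> : \sum_(v in C | v != a) (u v - (v == a)) = \sum_(v in C | v != a) u v.
  by apply: eq_bigr => v /andP[_ /negbTE ->]; rewrite subn0.
by lia.
Qed.

(* Weighted Koenig theorem. Remove one unit from a vertex [a] of positive weight,
   or from both ends of an edge at [a]. If neither preserves the covering
   hypothesis, then each neighbour of [a] lies with [a] in a cover of weight
   exactly [t]; the lattice operations merge these into one such cover, from
   which [a] can be dropped. *)
Lemma bipartite_packing (T : finType) (A : pred T) (e : rel T)
    (eA : forall a b, e a b -> A a && ~~ A b) (t : nat) (u : T -> nat) :
  (forall C, vertex_cover e C -> t <= \sum_(v in C) u v) ->
  exists s : seq (T * T),
    [/\ size s = t, all (fun p => e p.1 p.2) s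
      & forall v, \sum_(p <- s) ((v == p.1) + (v == p.2)) <= u v].
Proof.
have [N] := ubnP (\sum_v u v); elim: N t u => // N IH [|t] u leN cov.
  by exists [::]; split=> // v; rewrite big_nil.
have decr (u' : T -> nat) a : (forall v, u' v <= u v) -> u' a < u a ->
    \sum_v u' v < N.
  move=> le_u lt_a; apply: leq_trans (_ : \sum_v u v <= N); last by [].
  rewrite (bigD1 a) //= (bigD1 a (F := u)) //=.
  by rewrite -addSn; apply: leq_add => //; apply: leq_sum.
(* The side [A] is itself a cover, so its weight is positive. *)
have [a Aa ua] : exists2 a, A a & 0 < u a.
  have /cov : vertex_cover e [set v | A v].
    by apply/vertex_coverP => a b /eA; rewrite !inE => /andP[->].
  case: (pickP [pred a | A a & 0 < u a]) => [a /andP[] Aa ua _|A0].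
    by exists a.
  rewrite big1 // => v; rewrite inE => Av.
  by have := A0 v; rewrite /= Av lt0n => /negbFE/eqP.
case: (pickP [pred C : {set T} | [&& vertex_cover e C, a \in C
                                & \sum_(v in C) u v == t.+1]]); last first.
  move=> notight.
  case: (IH t.+1 (fun v => u v - (v == a))) => [||s [sz es le_s]].
  - by apply: (decr _ a) => [v|]; rewrite ?eqxx; clear -ua; lia.
  - move=> C cC; have := cov C cC; have := notight C; rewrite /= cC /=.
    by rewrite -(sum_sub_indicator C ua); case: (a \in C) => /=; lia.
  by exists s; split=> // v; apply: leq_trans (le_s v) (leq_subr _ _).
move=> C0 /and3P[cC0 aC0 /eqP tC0].
case: (pickP [pred b | [&& e a b, 0 < u b & ~~ [exists C : {set T},
   [&& vertex_cover e C, a \in C, b \in C & \sum_(v in C) u v == t.+1]]]]).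
  move=> b /and3P[eab ub /existsPn notight].
  have ab : a != b.
    by apply: contraTneq (eA _ _ eab) => <-; rewrite andbN.
  have ub' : 0 < u b - (b == a) by rewrite eq_sym (negbTE ab) subn0.
  case: (IH t (fun v => u v - (v == a) - (v == b))) => [||s [sz es le_s]].
  - by apply: (decr _ a) => [v|]; rewrite ?eqxx; clear -ua; lia.
  - move=> C cC; have := cov C cC; have := notight C; rewrite cC /=.
    rewrite -(sum_sub_indicator C ua) -(sum_sub_indicator C ub').
    by case: (a \in C); case: (b \in C) => /=; lia.
  exists ((a, b) :: s); split; rewrite /= ?sz ?eab // => v.
  rewrite big_cons /=; have := le_s v.
  case: (eqVneq v a) => [->|_]; first by rewrite (negbTE ab) /=; clear -ua; lia.
  by case: (eqVneq v b) => [->|_]; clear -ub; lia.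
move=> tight; exfalso.
have [D [cD aD tD nD]] : exists D : {set T}, [/\ vertex_cover e D, a \in D,
    \sum_(v in D) u v = t.+1 & forall b, b \in enum T -> e a b -> 0 < u b -> b \in D].
  elim: (enum T) => [|b l [D [cD aD tD nD]]]; first by exists C0.
  have [/andP[eab ub]|nb] := boolP (e a b && (0 < u b)); last first.
    exists D; split=> // b'; rewrite inE => /predU1P[->|]; last exact: nD.
    by move=> eab ub; rewrite eab ub in nb.
  have := tight b; rewrite /= eab ub /= => /negbFE/existsP[C].
  case/and4P=> cC aC bC /eqP tC.
  have Ab : A b = false by case/andP: (eA _ _ eab) => _ /negbTE.
  have lat := sum_lattice A u C D; rewrite tC tD in lat.
  have cov2 : vertex_cover e [set v | if A v then (v \in C) || (v \in D)
                      else (v \in C) && (v \in D)].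
    apply/vertex_coverP=> x y exy; case/andP: (eA _ _ exy) => Ax /negbTE Ay.
    move/vertex_coverP: cC => /(_ _ _ exy); move/vertex_coverP: cD => /(_ _ _ exy).
    by rewrite !inE Ax Ay; do 4![case: (_ \in _)].
  have cov1 : vertex_cover e [set v | if A v then (v \in C) && (v \in D)
                      else (v \in C) || (v \in D)].
    apply/vertex_coverP=> x y exy; case/andP: (eA _ _ exy) => Ax /negbTE Ay.
    move/vertex_coverP: cC => /(_ _ _ exy); move/vertex_coverP: cD => /(_ _ _ exy).
    by rewrite !inE Ax Ay; do 4![case: (_ \in _)].
  exists [set v | if A v then (v \in C) && (v \in D)
                  else (v \in C) || (v \in D)]; split=> //.
  - by rewrite !inE Aa aC aD.
  - apply/eqP; rewrite eqn_leq cov // andbT -(leq_add2r t.+1) -lat leq_add2l.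
    exact: cov.
  - move=> b' b'l eab' ub'; rewrite inE.
    have -> : A b' = false by case/andP: (eA _ _ eab') => _ /negbTE.
    move: b'l; rewrite inE => /predU1P[->|b'l]; first by rewrite bC.
    by rewrite nD ?orbT.
(* Edges at [a] stay covered without [a]: their other ends lie in [D] or have weight zero. The added
   vertices cost nothing, so the weight drops below [t.+1]. *)
have /cov : vertex_cover e ((D :\ a) :|: [set v | u v == 0]).
  apply/vertex_coverP=> x y exy; rewrite !inE.
  case/andP: (eA _ _ exy) => Ax Ay.
  have ya : y != a by apply: contraNneq Ay => ->.
  move/vertex_coverP: cD => /(_ _ _ exy); rewrite ya /=.
  case: (x =P a) exy => [->|_] exy /=; last by case/orP=> ->; rewrite ?orbT.
  case: (posnP (u y)) => [_|uy] _; first by rewrite !orbT.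
  by rewrite (nD y) ?mem_enum ?orbT.
apply/negP; rewrite -ltnNge -tD (bigD1 a aD) /= -{1}[\sum_(v in _) _]add0n.
have -> : \sum_(v in D :\ a :|: [set v | u v == 0]) u v =
  \sum_(v in D | v != a) u v.
  rewrite big_mkcond [RHS]big_mkcond /=; apply: eq_bigr => v _.
  rewrite !inE andbC; case: (_ && _) => //=.
  by case: (u v =P 0).
by rewrite ltn_add2r.
Qed.

(** * Tables with given margins *)

(* Frechet's lower bound for the corner sums of a table with given margins is
   attained by the tables supported on an antichain. *)
Lemma frechet_corner (V : finType) (row col : V -> nat) (comp : nat -> nat)
    (p u : V -> nat) (r c : nat) :
  {homo comp : k l / k <= l} ->
  (forall v w, 0 < u v -> 0 < u w -> comp (col v) = comp (col w) ->
     col v < col w -> row w <= row v) ->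
  (forall Q : nat -> nat -> bool,
     \sum_(v | Q (comp (col v)) (row v)) u v =
     \sum_(v | Q (comp (col v)) (row v)) p v) ->
  (forall Q : nat -> bool,
     \sum_(v | Q (col v)) u v = \sum_(v | Q (col v)) p v) ->
  \sum_(v | (r <= row v) && (c <= col v)) u v <=
  \sum_(v | (r <= row v) && (c <= col v)) p v.
Proof.
move=> comp_homo anti eq_row eq_col.
(* Either way the corner reduces to sums over whole intervals, where [u] and [p] agree. If the
   corner meets the support of [u] in the interval of [c], the antichain condition keeps the part of
   that interval left of [c] in rows at least [r], so pass to the complementary rows. Otherwise only
   later intervals contribute. *)
case: (pickP [pred v | [&& 0 < u v, r <= row v, c <= col v & comp (col v) == comp c]]).
  move=> v0 /and4P[uv0 rv0 cv0 /eqP kv0].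
  have split_col (x : V -> nat) :
     \sum_(v | (r <= row v) && (c <= col v)) x v +
     \sum_(v | (row v < r) && (c <= col v)) x v = \sum_(v | c <= col v) x v.
    rewrite [RHS](bigID (fun v => r <= row v)) /=.
    by congr addn; apply: eq_bigl => v; rewrite andbC -?ltnNge // andbC.
  have := split_col u; have := split_col p; rewrite -(eq_col (leq c)).
  suff: \sum_(v | (row v < r) && (c <= col v)) p v <=
     \sum_(v | (row v < r) && (c <= col v)) u v by lia.
  have -> : \sum_(v | (row v < r) && (c <= col v)) u v =
     \sum_(v | (row v < r) && (comp c <= comp (col v))) u v.
    rewrite big_mkcond [RHS]big_mkcond /=; apply: eq_bigr => v _.
    case: (ltnP (row v) r) => //= rv.
    case: (leqP c (col v)) => cv; first by rewrite comp_homo.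
    case: ifP => // kv; apply/esym/eqP; rewrite -leqn0 leqNgt; apply/negP => uv.
    have := comp_homo _ _ (ltnW cv) => kv'.
    have : row v0 <= row v; last by lia.
    by apply: anti => //; lia.
  rewrite (eq_row (fun k i => (i < r) && (comp c <= k))).
  rewrite big_mkcond [X in _ <= X]big_mkcond /=; apply: leq_sum => v _.
  case: (ltnP (row v) r) => //= rv.
  by case: (leqP c (col v)) => // cv; rewrite comp_homo.
move=> none.
have -> : \sum_(v | (r <= row v) && (c <= col v)) u v =
   \sum_(v | (r <= row v) && (comp c < comp (col v))) u v.
  rewrite big_mkcond [RHS]big_mkcond /=; apply: eq_bigr => v _.
  have := none v; rewrite /=; case: (leqP r (row v)) => //= rv.
  case: (leqP c (col v)) => cv /=.
    by have := comp_homo _ _ cv;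
      case: (ltngtP (comp c) (comp (col v))) => // E _;
      rewrite ?andbT lt0n => /negbFE/eqP.
  by move=> _; rewrite ltnNge comp_homo // ltnW.
rewrite (eq_row (fun k i => (r <= i) && (comp c < k))).
rewrite big_mkcond [X in _ <= X]big_mkcond /=; apply: leq_sum => v _.
case: (leqP r (row v)) => //= rv.
case: (leqP c (col v)) => cv; first by case: ifP.
by rewrite ltnNge comp_homo // ltnW.
Qed.

(** Each entry is a mixed second difference of corner sums. *)
Lemma corner_inj (V : finType) (row col : V -> nat) (p u : V -> nat) :
  (forall v w, row v = row w -> col v = col w -> v = w) ->
  (forall r c, \sum_(v | (r <= row v) && (c <= col v)) u v =
               \sum_(v | (r <= row v) && (c <= col v)) p v) -> u =1 p.
Proof.
move=> inj eqN v.
pose N (x : V -> nat) r c := \sum_(v | (r <= row v) && (c <= col v)) x v.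
have mob (x : V -> nat) : x v + N x (row v).+1 (col v) + N x (row v) (col v).+1 =
   N x (row v) (col v) + N x (row v).+1 (col v).+1.
  have -> : x v = \sum_(w | (row w == row v) && (col w == col v)) x w.
    rewrite (big_pred1 v) // => w /=.
    by apply/andP/eqP => [[/eqP ? /eqP ?]|->//]; apply: inj.
  rewrite /N !(big_mkcond (fun w => _ && _)) -!big_split /=.
  apply: eq_bigr => w _; move: (x w) => z.
  by case: (ltngtP (row v)); case: (ltngtP (col v)) => /=; rewrite ?addn0 ?add0n // addnC.
have mu := mob u; have mp := mob p.
by rewrite /N !eqN -/(N p _ _) -mp -!addnA in mu; apply: addIn mu.
Qed.

Definition wt (V : finType) (row col : V -> nat) (u : V -> nat) : nat :=
  \sum_v u v * ((row v).+1 * (col v).+1).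

(** The factor [(row v).+1 * (col v).+1] counts the corners containing [v]. *)
Lemma wt_corner (V : finType) (m n : nat) (row : V -> 'I_m) (col : V -> 'I_n) (u : V -> nat) :
  wt row col u =
  \sum_(x : 'I_m * 'I_n) \sum_(v | (x.1 <= row v) && (x.2 <= col v)) u v.
Proof.
rewrite (exchange_big_dep xpredT) //=; apply: eq_bigr => v _.
rewrite sum_nat_const mulnC; congr muln.
rewrite -[_.+1]card_ord -[X in _ * X]card_ord -card_prod.
have f_lt1 (x : 'I_(row v).+1) : x < m by apply: leq_trans (ltn_ord x) (ltn_ord (row v)).
have f_lt2 (x : 'I_(col v).+1) : x < n by apply: leq_trans (ltn_ord x) (ltn_ord (col v)).
pose f (x : 'I_(row v).+1 * 'I_(col v).+1) := (Ordinal (f_lt1 x.1), Ordinal (f_lt2 x.2)).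
rewrite -(card_imset _ (f := f)); last first.
  by move=> [x y] [x' y'] [E1 E2]; congr pair; apply: val_inj.
apply: eq_card => -[x y]; apply/imsetP/andP => /= [[[x' y'] _ [-> ->]]|] /=.
  by split; rewrite -ltnS ltn_ord.
move=> [lx ly].
exists (Ordinal (lx : x < (row v).+1), Ordinal (ly : y < (col v).+1)) => //.
by congr pair; apply: val_inj.
Qed.

(** No corner sum of [u] exceeds that of [p], and the weight adds up all corner sums; the reverse
    inequality of weights thus forces equality in each. *)
Lemma margins_wt_inj (V : finType) (m n : nat) (row : V -> 'I_m) (col : V -> 'I_n)
    (comp : nat -> nat) (p u : V -> nat) :
  (forall v w, row v = row w -> col v = col w -> v = w) ->
  {homo comp : k l / k <= l} ->
  (forall v w, 0 < u v -> 0 < u w -> comp (col v) = comp (col w) ->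
     col v < col w -> row w <= row v) ->
  (forall Q : nat -> nat -> bool,
     \sum_(v | Q (comp (col v)) (row v)) u v =
     \sum_(v | Q (comp (col v)) (row v)) p v) ->
  (forall Q : nat -> bool,
     \sum_(v | Q (col v)) u v = \sum_(v | Q (col v)) p v) ->
  wt row col p <= wt row col u -> u =1 p.
Proof.
move=> inj comp_homo anti eq_row eq_col; rewrite !wt_corner => le_wt.
apply: (@corner_inj V row col) => [v w /val_inj ? /val_inj|r c]; first exact: inj.
have le_N x y := frechet_corner x y comp_homo anti eq_row eq_col.
case: (ltnP r m) => rm; last first.
  by rewrite !big_pred0 // => v; rewrite leqNgt (leq_trans (ltn_ord _) rm).
case: (ltnP c n) => cn; last first.
  by rewrite !big_pred0 // => v; rewrite andbC leqNgt (leq_trans (ltn_ord _) cn).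
move: le_wt; rewrite (bigD1 (Ordinal rm, Ordinal cn)) //=.
rewrite [X in _ <= X](bigD1 (Ordinal rm, Ordinal cn)) //=.
set o := (_, _).
have leR : \sum_(x | x != o) \sum_(v | (x.1 <= row v) && (x.2 <= col v)) u v <=
           \sum_(x | x != o) \sum_(v | (x.1 <= row v) && (x.2 <= col v)) p v.
  by apply: leq_sum => x _; apply: le_N.
move=> le_wt; apply/eqP; rewrite eqn_leq le_N /=.
move: leR; rewrite -(leq_add2l (\sum_(v | (r <= row v) && (c <= col v)) u v)).
by move/(leq_trans le_wt); rewrite leq_add2r.
Qed.

(** * Order of Taylor expansions *)

Local Open Scope ring_scope.

Lemma mpolyX_inj (R : nzRingType) (N : nat) : injective (fun u => 'X_[u] : {mpoly R[N]}).
Proof.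
move=> u v /(congr1 (mcoeff u)); rewrite !mcoeffX eqxx => /eqP.
by case: (eqVneq v u) => // _; rewrite oner_eq0.
Qed.

Definition ord_ge (R : comNzRingType) (n t : nat) (p : {mpoly R[n]}) : Prop :=
  forall q : 'X_{1..n}, (mdeg q < t)%N -> p@_q = 0.

Lemma ord_ge0 (R : comNzRingType) (n : nat) (p : {mpoly R[n]}) : ord_ge 0 p.
Proof. by move=> q; rewrite ltn0. Qed.

Lemma ord_geM (R : comNzRingType) (n s t : nat) (p q : {mpoly R[n]}) :
  ord_ge s p -> ord_ge t q -> ord_ge (s + t) (p * q).
Proof.
move=> Hp Hq k lt_k; rewrite mcoeffM big1 // => i /eqP/(congr1 (@mdeg n)).
rewrite mdegD => E; have {lt_k} : (mdeg i.1 + mdeg i.2 < s + t)%N by rewrite -E.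
case: (ltnP (mdeg i.1) s) => [/Hp ->|le_s]; first by rewrite mul0r.
case: (ltnP (mdeg i.2) t) => [/Hq ->|le_t]; first by rewrite mulr0.
by rewrite ltnNge leq_add.
Qed.

Lemma ord_geD (R : comNzRingType) (n t : nat) (p q : {mpoly R[n]}) :
  ord_ge t p -> ord_ge t q -> ord_ge t (p + q).
Proof. by move=> Hp Hq k lt_k; rewrite mcoeffD Hp ?Hq ?addr0. Qed.

Lemma ord_geN (R : comNzRingType) (n t : nat) (p : {mpoly R[n]}) :
  ord_ge t p -> ord_ge t (- p).
Proof. by move=> Hp k lt_k; rewrite mcoeffN Hp ?oppr0. Qed.

(** In the coefficient of [p * q] at [k], every term but [p@_0 * q@_k] contains a coefficient of [q]
    of smaller degree, zero by induction. *)
Lemma ord_ge_cancel (R : idomainType) (n t : nat) (p q : {mpoly R[n]}) :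
  p@_0%MM != 0 -> ord_ge t (p * q) -> ord_ge t q.
Proof.
move=> p0 Hpq k; have [N] := ubnP (mdeg k); elim: N k => // N IH k ltN lt_t.
have lower (k1 k2 : 'X_{1..n}) : k = (k1 + k2)%MM -> k1 != 0%MM -> q@_k2 = 0.
  move=> E; rewrite -mdeg_eq0 -lt0n => k1_gt0.
  have Ed : mdeg k = (mdeg k1 + mdeg k2)%N by rewrite -mdegD -E.
  apply: IH; last by apply: leq_ltn_trans lt_t; rewrite Ed leq_addl.
  by apply: leq_trans (ltN : mdeg k <= N)%N; rewrite Ed -[X in (X < _)%N]add0n ltn_add2r.
have := Hpq k lt_t; rewrite mcoeffM.
have lt0 : (mdeg (0%MM : 'X_{1..n}) < (mdeg k).+1)%N by rewrite mdeg0.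
rewrite (bigD1 (BMultinom lt0, BMultinom (ltnSn (mdeg k)))) /=; last first.
  by rewrite add0m.
rewrite big1 ?addr0 => [/eqP|i /andP[/eqP E neq]]; last first.
  rewrite (lower _ _ E) ?mulr0 //; apply: contraNneq neq => E1.
  move/esym: E; rewrite E1 add0m => E2.
  by apply/eqP/injective_projections; apply: val_inj.
by rewrite mulf_eq0 (negbTE p0) => /eqP.
Qed.

(* [f] maps to [f (c + Y)], expanded in powers of the new variables [Y]; it is
   locked because unfolding it makes conversion diverge. *)
HB.lock Definition taylor (K : fieldType) (L N : nat) (c : 'I_N -> {mpoly K[L]})
    : {mpoly K[N]} -> {mpoly {mpoly K[L]}[N]} :=
  mmap (@mpolyC N {mpoly K[L]} \o @mpolyC L K) (fun v => (c v)%:MP + 'X_v).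

Section TaylorMorphism.
Variables (K : fieldType) (L N : nat) (c : 'I_N -> {mpoly K[L]}).
Let phi : {rmorphism {mpoly K[N]} -> {mpoly {mpoly K[L]}[N]}} :=
  mmap (@mpolyC N {mpoly K[L]} \o @mpolyC L K) (fun v => (c v)%:MP + 'X_v).

Lemma taylor0 : taylor c 0 = 0. Proof. rewrite !taylor.unlock; exact: (rmorph0 phi). Qed.

Lemma taylor1 : taylor c 1 = 1. Proof. rewrite !taylor.unlock; exact: (rmorph1 phi). Qed.

Lemma taylorD f g : taylor c (f + g) = taylor c f + taylor c g.
Proof. rewrite !taylor.unlock; exact: (rmorphD phi). Qed.

Lemma taylorB f g : taylor c (f - g) = taylor c f - taylor c g.
Proof. rewrite !taylor.unlock; exact: (rmorphB phi). Qed.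

Lemma taylorM f g : taylor c (f * g) = taylor c f * taylor c g.
Proof. rewrite !taylor.unlock; exact: (rmorphM phi). Qed.

End TaylorMorphism.

(** The common bound [B] lets a product over [v] be expanded over functions into a single ['I_B]. *)
Lemma exprD_mpolyX (R : comNzRingType) (N : nat) (c : R) (v : 'I_N) (k B : nat) :
  (k < B)%N ->
  (c%:MP + 'X_v) ^+ k =
  \sum_(i < B) (c ^+ (k - i) *+ 'C(k, i))%:MP * 'X_[U_(v) *+ i] :> {mpoly R[N]}.
Proof.
move=> kB; rewrite exprDn.
rewrite (big_ord_widen _ (fun i => (c%:MP ^+ (k - i) * 'X_v ^+ i) *+ 'C(k, i)) kB).
rewrite big_mkcond /=; apply: eq_bigr => i _.
rewrite mpolyXn -rmorphXn rmorphMn /= mulrnAl.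
by case: ltnP => // lt_ki; rewrite bin_small.
Qed.

(** These are the Hasse derivatives of the monomial at [c], valid in every characteristic. *)
Lemma taylorX (K : fieldType) (L N : nat) (c : 'I_N -> {mpoly K[L]}) (u q : 'X_{1..N}) :
  (taylor c 'X_[u])@_q =
  (\prod_v 'C(u v, q v))%:R * \prod_v c v ^+ (u v - q v).
Proof.
rewrite taylor.unlock mmapX /mmap1.
pose B := (mdeg u + mdeg q).+1.
have le_mdeg (w : 'X_{1..N}) v : (w v <= mdeg w)%N.
  by rewrite mdegE (bigD1 v) //= leq_addr.
have uB v : (u v < B)%N by rewrite ltnS (leq_trans (le_mdeg u v)) ?leq_addr.
have qB v : (q v < B)%N by rewrite ltnS (leq_trans (le_mdeg q v)) ?leq_addl.
rewrite (eq_bigr _ (fun v _ => exprD_mpolyX (c v) v (uB v))).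
rewrite bigA_distr_bigA /= raddf_sum /=.
have coefE (f : {ffun 'I_N -> 'I_B}) :
  (\prod_i ((c i ^+ (u i - f i) *+ 'C(u i, f i))%:MP * 'X_[U_(i) *+ f i]))@_q =
  (\prod_i (c i ^+ (u i - f i) *+ 'C(u i, f i))) * ((\sum_i U_(i) *+ f i)%MM == q)%:R.
  rewrite big_split /= -rmorph_prod mcoeffCM; congr (_ * _).
  by rewrite -mcoeffX; congr mcoeff; apply: mprodXE.
rewrite (eq_bigr _ (fun f _ => coefE f)).
have sumE (f : {ffun 'I_N -> 'I_B}) v : ((\sum_i U_(i) *+ f i)%MM v = f v).
  rewrite mnm_sumE (bigD1 v) //= big1 => [|w nw]; rewrite mulmnE mnm1E.
    by rewrite eqxx mul1n addn0.
  by rewrite (negbTE nw).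
rewrite (bigD1 [ffun v => Ordinal (qB v)]) //= [X in _ + X]big1 ?addr0 => [|f nf]; last first.
  have [E|] := eqVneq (\sum_i U_(i) *+ f i)%MM q; last by rewrite mulr0.
  case/negP: nf; apply/eqP/ffunP=> v; apply: val_inj; rewrite ffunE /=.
  by rewrite -E sumE.
have -> : (\sum_i U_(i) *+ [ffun v => Ordinal (qB v)] i)%MM = q.
  by apply/mnmP=> v; rewrite sumE ffunE.
rewrite eqxx mulr1 natr_prod -big_split /=; apply: eq_bigr => v _.
by rewrite ffunE /= mulr_natl.
Qed.

Lemma taylor_coef (K : fieldType) (L N : nat) (c : 'I_N -> {mpoly K[L]})
    (f : {mpoly K[N]}) (q : 'X_{1..N}) :
  (taylor c f)@_q = \sum_(u <- msupp f)
     f@_u *: ((\prod_v 'C(u v, q v))%:R * \prod_v c v ^+ (u v - q v)).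
Proof.
rewrite {1}taylor.unlock {1}/mmap raddf_sum /=; apply: eq_bigr => u _.
by rewrite mcoeffCM mul_mpolyC -taylorX taylor.unlock mmapX.
Qed.

Lemma taylor0X (K : fieldType) (L N : nat) (c : 'I_N -> {mpoly K[L]}) (v : 'I_N) :
  (taylor c 'X_v)@_0%MM = c v.
Proof.
by rewrite taylor.unlock mmapX mmap1U mcoeffD mpolyCK mcoeffX mnm1_eq0 addr0.
Qed.

(** * Cut sets of the path *)

Definition row_of (m n : nat) (v : 'I_(m * n)) : 'I_m :=
  (enum_val (cast_ord (esym (mxvec_cast m n)) v)).1.
Definition col_of (m n : nat) (v : 'I_(m * n)) : 'I_n :=
  (enum_val (cast_ord (esym (mxvec_cast m n)) v)).2.

Lemma row_of_index (m n : nat) (i : 'I_m) (k : 'I_n) : row_of (mxvec_index i k) = i.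
Proof. by rewrite /row_of cast_ordK enum_rankK. Qed.

Lemma col_of_index (m n : nat) (i : 'I_m) (k : 'I_n) : col_of (mxvec_index i k) = k.
Proof. by rewrite /col_of cast_ordK enum_rankK. Qed.

Lemma row_col_index (m n : nat) (v : 'I_(m * n)) : mxvec_index (row_of v) (col_of v) = v.
Proof. by case/mxvec_indexP: v => i k; rewrite row_of_index col_of_index. Qed.

Lemma row_col_inj (m n : nat) (v w : 'I_(m * n)) :
  row_of v = row_of w -> col_of v = col_of w -> v = w.
Proof. by move=> er ec; rewrite -(row_col_index v) er ec row_col_index. Qed.

(* Removing the columns in [S] cuts the path into intervals; [comp_idx S k] is the
   index of the interval containing [k]. *)
Definition comp_idx (n : nat) (S : {set 'I_n}) (k : nat) : nat :=
  #|[set s in S | (s < k)%N]|.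

Lemma comp_idx_homo (n : nat) (S : {set 'I_n}) : {homo comp_idx S : k l / (k <= l)%N}.
Proof.
move=> k l kl; apply/subset_leq_card/subsetP => s; rewrite !inE => /andP[-> sk].
exact: leq_trans sk kl.
Qed.

Lemma comp_idx_le (n : nat) (S : {set 'I_n}) (k : nat) : (comp_idx S k < n.+1)%N.
Proof. by rewrite ltnS -[X in (_ <= X)%N]card_ord max_card. Qed.

Lemma comp_idx_eqP (n : nat) (S : {set 'I_n}) (k l : nat) : (k <= l)%N ->
  comp_idx S k = comp_idx S l <-> (forall s, s \in S -> (k <= s)%N -> (l <= s)%N).
Proof.
move=> kl; split=> [E s sS ks|H].
  have sub : [set s in S | (s < k)%N] \subset [set s in S | (s < l)%N].
    by apply/subsetP => x; rewrite !inE => /andP[-> xk]; apply: leq_trans xk kl.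
  have /eqP Es : [set s in S | (s < k)%N] == [set s in S | (s < l)%N].
    by rewrite eqEcard sub /= -[X in (X <= _)%N]E.
  by move/setP: Es => /(_ s); rewrite !inE sS /= ltnNge ks /=; case: ltnP.
apply: eq_card => s; rewrite !inE; case sS: (s \in S) => //=.
apply/idP/idP => [sk|]; first exact: leq_trans sk kl.
by rewrite !ltnNge; apply: contra; apply: H.
Qed.

(* The cut sets of the path: they index the minimal primes of the ideal. *)
Definition cut_set (n : nat) (S : {set 'I_n}) : Prop :=
  forall k, k \in S ->
    (exists2 l, l \notin S & k = l.+1 :> nat) /\
    (exists2 l, l \notin S & l = k.+1 :> nat).

(** The pairs of positions whose variables form the diagonal term of a generator. *)
Definition diag (m n : nat) (v w : 'I_(m * n)) : bool :=
  (row_of v < row_of w)%N && (col_of w == (col_of v).+1 :> nat).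

Lemma packing_or_cover (m n : nat) (m_gt0 : (0 < m)%N) (t : nat) (u : 'I_(m * n) -> nat) :
  (exists s : seq ('I_(m * n) * 'I_(m * n)),
    [/\ size s = t, all (fun p => diag p.1 p.2) s
      & forall v, (\sum_(p <- s) ((v == p.1) + (v == p.2)) <= u v)%N]) \/
  (exists (C : {set 'I_(m * n)}) (S : {set 'I_n}),
    [/\ cut_set S, forall v, col_of v \in S -> v \in C,
        forall v w, v \notin C -> w \notin C ->
          comp_idx S (col_of v) = comp_idx S (col_of w) ->
          (col_of v < col_of w)%N -> (row_of w <= row_of v)%N
      & (\sum_(v in C) u v < t)%N]).
Proof.
(* Adjacent columns have opposite parity, so the graph of diagonal terms is bipartite. *)
pose A (v : 'I_(m * n)) := ~~ odd (col_of v).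
pose e v w := [&& A v, ~~ A w & diag v w || diag w v].
have eA a b : e a b -> A a && ~~ A b by case/and3P=> -> ->.
have coverE (C : {set 'I_(m * n)}) : vertex_cover e C ->
    forall v w, diag v w -> (v \in C) || (w \in C).
  move/vertex_coverP => cC v w dvw.
  have par : A w = ~~ A v by case/andP: dvw => _ /eqP E; rewrite /A E.
  case Av : (A v) par => par.
    by apply: cC; rewrite /e Av par dvw.
  by rewrite orbC; apply: cC; rewrite /e Av par dvw orbT.
case: (pickP [pred C : {set 'I_(m * n)} | vertex_cover e C && (\sum_(v in C) u v < t)%N]);
  last first.
  move=> big; left.
  have [|s [sz es le_s]] := bipartite_packing eA (t := t) (u := u).
    by move=> C cC; have := big C; rewrite /= cC /=; case: ltnP.
  exists [seq if diag p.1 p.2 then p else (p.2, p.1) | p <- s]; split.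
  - by rewrite size_map.
  - rewrite all_map; apply: sub_all es => p /and3P[_ _]; rewrite /=.
    by case: ifP => //=.
  - move=> v; rewrite big_map; apply: leq_trans (le_s v).
    by apply: leq_sum => p _; case: ifP => //= _; rewrite addnC.
move=> C0 /andP[cC0 lt0]; right.
(* Minimality gives each vertex of [C] a neighbour outside [C]. *)
have [C /minsetP[cC minC] subC] := minset_exists cC0.
have diag_irr (v : 'I_(m * n)) : diag v v = false by rewrite /diag ltnn.
have nbr v : v \in C -> exists2 w, w \notin C & diag v w || diag w v.
  move=> vC; case: (boolP (vertex_cover e (C :\ v))) => [cov|].
    by have /setP/(_ v) := minC _ cov (subD1set _ _); rewrite !inE eqxx vC.
  rewrite negb_forall => /existsP[a]; rewrite negb_forall => /existsP[b].
  rewrite negb_imply negb_or => /andP[/and3P[Aa Ab dab]].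
  rewrite !inE !negb_and !negbK => /andP[aC bC].
  have /orP cab : (a \in C) || (b \in C).
    by case/orP: dab => /(coverE C cC) //; rewrite orbC.
  case: (eqVneq a v) aC dab cab => [->|_] /= aC dab cab.
    exists b; last by [].
    by case: (eqVneq b v) bC dab => // ->; rewrite diag_irr.
  case: (eqVneq b v) bC dab => [->|_] /= bC dab; first by exists a; rewrite // orbC.
  by case: cab; rewrite ?(negbTE aC) ?(negbTE bC).
pose S := [set k | [forall v : 'I_(m * n), (col_of v == k) ==> (v \in C)]].
have inS k : reflect (forall v, col_of v = k -> v \in C) (k \in S).
  rewrite inE; apply: (iffP forallP) => [H v /eqP vk|H v].
    by have /implyP := H v; apply.
  by apply/implyP => /eqP; apply: H.
have notS v : v \notin C -> col_of v \notin S.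
  by move=> vC; apply: contra vC => /inS; apply.
exists C, S; split.
- move=> k kS; split.
    (* A vertex in the last row can only be the right end of an edge, so its neighbour outside [C]
       is in the previous column; dually, the first row reaches the next column. *)
    have last_row : (m.-1 < m)%N by rewrite prednK.
    case: (nbr (mxvec_index (Ordinal last_row) k)) => [|w wC].
      by apply: (inS _ kS); rewrite col_of_index.
    rewrite /diag row_of_index col_of_index /= => /orP[/andP[]|/andP[_ /eqP E]].
      by rewrite ltnNge -ltnS prednK // ltn_ord.
    by exists (col_of w); first exact: notS.
  case: (nbr (mxvec_index (Ordinal m_gt0) k)) => [|w wC].
    by apply: (inS _ kS); rewrite col_of_index.
  rewrite /diag row_of_index col_of_index /= orbF => /andP[_ /eqP E].
  by exists (col_of w); first exact: notS.
- by move=> v /inS; apply.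
(* Induction on the distance of the columns: a column strictly between is not in [S], hence has a
   vertex off [C] that links the two rows. In adjacent columns an increase would be an uncovered
   edge. *)
- have step d : forall v w, v \notin C -> w \notin C ->
     col_of w = (col_of v + d.+1)%N :> nat ->
     (forall s, s \in S -> (col_of v <= s)%N -> (col_of w <= s)%N) ->
     (row_of w <= row_of v)%N.
    elim: d => [|d IH] v w vC wC E noS.
      rewrite leqNgt; apply/negP => lt_vw.
      have := coverE C cC v w; rewrite /diag lt_vw E addn1 eqxx /=.
      by rewrite (negbTE vC) (negbTE wC) => /(_ isT).
    have kn : ((col_of v).+1 < n)%N.
      by apply: leq_ltn_trans (ltn_ord (col_of w)); rewrite E -addn1 leq_add2l.
    have kS : Ordinal kn \notin S.
      by apply/negP => /noS /= /(_ (leqnSn _)); rewrite E; lia.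
    have [x xk xC] : exists2 x, col_of x = Ordinal kn & x \notin C.
      move: kS; rewrite inE negb_forall => /existsP[x]; rewrite negb_imply.
      by case/andP=> /eqP; exists x.
    apply: leq_trans (IH x w xC wC _ _) _.
    + by rewrite E xk /= addSnnS.
    + by move=> s sS; rewrite xk => /= /ltnW; apply: noS.
    rewrite leqNgt; apply/negP => lt_vw.
    have := coverE C cC v x; rewrite /diag lt_vw xk /= eqxx /=.
    by rewrite (negbTE vC) (negbTE xC) => /(_ isT).
  move=> v w vC wC /(comp_idx_eqP _ (ltnW _)) E lt_vw.
  apply: (step (col_of w - (col_of v).+1)%N) => //; last exact: E.
  by rewrite addnS -addSn subnKC.
- apply: leq_ltn_trans lt0; rewrite big_mkcond [X in (_ <= X)%N]big_mkcond /=.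
  apply: leq_sum => v _; case: ifP => // vC.
  by rewrite (subsetP subC).
Qed.

(** * Generic rank-one matrices on the intervals *)

(* Variables [a_(c, i)], one for each interval [c] and row [i], and [b_k]. *)
Definition nparam (m n : nat) : nat := #|{: ('I_n.+1 * 'I_m) + 'I_n}|.

Definition param_monomial (m n : nat) (S : {set 'I_n}) (v : 'I_(m * n)) : 'X_{1..nparam m n} :=
  (U_(enum_rank (inl (inord (comp_idx S (col_of v)), row_of v))) +
   U_(enum_rank (inr (col_of v))))%MM.

(* The matrix [a_(c, i) * b_k], generic of rank one on each interval of columns
   and zero on the columns in [S]. *)
Definition rank_one (K : fieldType) (m n : nat) (S : {set 'I_n}) (v : 'I_(m * n)) :
    {mpoly K[nparam m n]} :=
  if col_of v \in S then 0 else 'X_[param_monomial S v].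

(** The exponents of the [a] variables are the row sums of [p] on each interval, those of the [b]
    variables its column sums. *)
Definition margin (m n : nat) (S : {set 'I_n}) (p : 'X_{1..m * n}) : 'X_{1..nparam m n} :=
  (\sum_v param_monomial S v *+ p v)%MM.

Lemma prod_rank_one (K : fieldType) (m n : nat) (S : {set 'I_n}) (p : 'X_{1..m * n}) :
  \prod_v rank_one K S v ^+ p v =
  if [forall v, (col_of v \in S) ==> (p v == 0%N)] then 'X_[margin S p] else 0.
Proof.
case: ifP => [/forallP H|/negbT].
  rewrite -mprodXnE; apply: eq_bigr => v _; rewrite /rank_one.
  by case: ifP => // vS; have := H v; rewrite vS => /eqP ->; rewrite !expr0.
rewrite negb_forall => /existsP[v]; rewrite negb_imply => /andP[vS pv].
by rewrite (bigD1 v) //= /rank_one vS expr0n (negbTE pv) mul0r.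
Qed.

Lemma eq_sum_key (V Z : finType) (key : V -> Z) (u p : V -> nat) :
  (forall z, \sum_(v | key v == z) u v = \sum_(v | key v == z) p v)%N ->
  forall Q : pred Z, (\sum_(v | Q (key v)) u v = \sum_(v | Q (key v)) p v)%N.
Proof.
move=> H Q.
rewrite (partition_big key Q) // [RHS](partition_big key Q) //=.
apply: eq_bigr => z Qz; have E v : Q (key v) && (key v == z) = (key v == z).
  by rewrite andb_idl // => /eqP ->.
by rewrite !(eq_bigl _ _ E).
Qed.

Lemma margin_inl (m n : nat) (S : {set 'I_n}) (p : 'X_{1..m * n}) z :
  margin S p (enum_rank (inl z)) =
  (\sum_(v | (inord (comp_idx S (col_of v)), row_of v) == z) p v)%N.
Proof.
rewrite mnm_sumE [RHS]big_mkcond /=; apply: eq_bigr => v _.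
rewrite mulmnE mnmDE !mnm1E !(inj_eq enum_rank_inj) addn0.
by rewrite [inl _ == inl _]/(_ == _) /=; case: (_ == z); rewrite ?mul1n.
Qed.

Lemma margin_inr (m n : nat) (S : {set 'I_n}) (p : 'X_{1..m * n}) k :
  margin S p (enum_rank (inr k)) = (\sum_(v | col_of v == k) p v)%N.
Proof.
rewrite mnm_sumE [RHS]big_mkcond /=; apply: eq_bigr => v _.
rewrite mulmnE mnmDE !mnm1E !(inj_eq enum_rank_inj) add0n.
by rewrite [inr _ == inr _]/(_ == _) /=; case: (_ == k); rewrite ?mul1n.
Qed.

Lemma margin_eq (m n : nat) (S : {set 'I_n}) (u p : 'X_{1..m * n}) :
  margin S u = margin S p ->
  (forall Q : nat -> nat -> bool,
     \sum_(v | Q (comp_idx S (col_of v)) (row_of v)) u v =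
     \sum_(v | Q (comp_idx S (col_of v)) (row_of v)) p v)%N /\
  (forall Q : nat -> bool,
     \sum_(v | Q (col_of v)) u v = \sum_(v | Q (col_of v)) p v)%N.
Proof.
move=> E; split=> Q; last first.
  apply: (@eq_sum_key _ _ (@col_of m n) u p _ (fun k => Q k)) => k.
  by rewrite -!(margin_inr S) E.
have key (x : 'X_{1..m * n}) :
   (\sum_(v | Q (comp_idx S (col_of v)) (row_of v)) x v =
    \sum_(v | (fun z : 'I_n.+1 * 'I_m => Q z.1 z.2)
       (inord (comp_idx S (col_of v)), row_of v)) x v)%N.
  by apply: eq_bigl => v /=; rewrite inordK // comp_idx_le.
rewrite !key.
apply: (@eq_sum_key _ _ (fun v => (inord (comp_idx S (col_of v)), row_of v)) u p _
         (fun z : 'I_n.+1 * 'I_m => Q z.1 z.2)) => z.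
by rewrite -!margin_inl E.
Qed.

(** * Weights of monomials and coefficients of top weight *)

Definition weight (m n : nat) (u : 'X_{1..m * n}) : nat :=
  wt (fun v => row_of v) (fun v => col_of v) u.

Lemma weightD (m n : nat) (u p : 'X_{1..m * n}) :
  weight (u + p)%MM = (weight u + weight p)%N.
Proof.
by rewrite /weight /wt -big_split; apply: eq_bigr => v _; rewrite mnmDE mulnDl.
Qed.

Lemma weight1 (m n : nat) (v : 'I_(m * n)) :
  weight U_(v)%MM = ((row_of v).+1 * (col_of v).+1)%N.
Proof.
rewrite /weight /wt (bigD1 v) //= mnm1E eqxx mul1n big1 ?addn0 // => w.
by rewrite mnm1E eq_sym => /negbTE ->.
Qed.

(* A monomial of [f] contributing to this coefficient is [u] restricted to [C] times
   a monomial with the same margins as [u] off [C]; by the Frechet bound it would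
   outweigh [u]. *)
Lemma top_coef (K : fieldType) (m n : nat) (C : {set 'I_(m * n)}) (S : {set 'I_n})
    (f : {mpoly K[m * n]}) (u : 'X_{1..m * n}) :
  (forall v, col_of v \in S -> v \in C) ->
  (forall v w, v \notin C -> w \notin C ->
     comp_idx S (col_of v) = comp_idx S (col_of w) ->
     (col_of v < col_of w)%N -> (row_of w <= row_of v)%N) ->
  (forall p, p \in msupp f -> (weight p <= weight u)%N) -> u \in msupp f ->
  (taylor (rank_one K S) f)@_[multinom (if v \in C then u v else 0%N) | v < m * n]
    @_(margin S [multinom (if v \in C then 0%N else u v) | v < m * n]) = f@_u.
Proof.
move=> subC anti top uf; set r := [multinom (if _ then 0%N else _) | _ < _].
set q := [multinom _ | _ < _].
have qr : u = (r + q)%MM.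
  by apply/mnmP=> v; rewrite mnmDE !mnmE; case: ifP; rewrite ?addn0.
have termE p : p \in msupp f ->
   (f@_p *: ((\prod_v 'C(p v, q v))%:R * \prod_v rank_one K S v ^+ (p v - q v)))
   @_(margin S r) = f@_p * (p == u)%:R.
  move=> pf; rewrite mcoeffZ; congr (_ * _).
  (* Unless [q] divides [p], a binomial coefficient vanishes. *)
  case: (boolP (q <= p)%MM) => [qp|]; last first.
    rewrite /lem negb_forall => /existsP[v]; rewrite -ltnNge => lt_v.
    rewrite (bigD1 v) //= bin_small // mul0n mul0r mcoeff0.
    by case: eqP => // E; move: lt_v; rewrite E mnmE; case: ifP; rewrite ?ltnn ?ltn0.
  have pE : p = (p - q + q)%MM by rewrite submK.
  have -> : \prod_v rank_one K S v ^+ (p v - q v) = \prod_v rank_one K S v ^+ (p - q)%MM v.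
    by apply: eq_bigr => v _; rewrite mnmBE.
  rewrite prod_rank_one mulr_natl mcoeffMn.
  case: (eqVneq p u) => [pu|neq].
    have -> : (p - q)%MM = r by rewrite pu qr addmK.
    have -> : [forall v, (col_of v \in S) ==> (r v == 0%N)].
      by apply/forallP=> v; apply/implyP => /subC vC; rewrite mnmE vC.
    (* Each binomial is ['C(u v, u v)] or ['C(u v, 0)], so no characteristic can kill the
       coefficient. *)
    rewrite mcoeffX eqxx big1 // => v _; rewrite pu /q mnmE.
    by case: ifP; rewrite ?binn ?bin0.
  case: ifP => _; last by rewrite mcoeff0 mul0rn.
  rewrite mcoeffX; case: eqP => [/esym/margin_eq[eq_row eq_col]|]; last by rewrite mul0rn.
  case/eqP: neq; rewrite pE qr; congr (_ + _)%MM; apply/mnmP => v; apply/esym; move: v.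
  apply: (margins_wt_inj (row := @row_of m n) (col := @col_of m n) (comp := comp_idx S)) => //.
  - exact: row_col_inj.
  - exact: comp_idx_homo.
  - by move=> v w; rewrite !mnmE; do 2![case: ifP => // /negbT ?] => _ _; apply: anti.
  - by have := top p pf; rewrite {1}pE qr !weightD leq_add2r.
rewrite taylor_coef raddf_sum /= (eq_big_seq _ termE).
rewrite (bigD1_seq u) ?msupp_uniq //= eqxx mulr1 big1 ?addr0 // => p /negbTE ->.
by rewrite mulr0.
Qed.

(** * Ideals *)

Lemma ideal_gen_ideal (R : comNzRingType) (G : R -> Prop) : is_ideal (ideal_gen G).
Proof.
split; [|split].
- by exists [::]; split=> //; rewrite big_nil.
- move=> a b [s [Gs ->]] [s' [Gs' ->]]; exists (s ++ s'); split.
    by move=> p; rewrite mem_cat => /orP[/Gs|/Gs'].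
  by rewrite big_cat.
- move=> r a [s [Gs ->]]; exists [seq (r * p.1, p.2) | p <- s]; split.
    by move=> p /mapP[p' /Gs Gp' ->].
  by rewrite big_map mulr_sumr; apply: eq_bigr => p _; rewrite mulrA.
Qed.

Lemma ideal_gen_sub (R : comNzRingType) (G : R -> Prop) (g : R) : G g -> ideal_gen G g.
Proof.
move=> Gg; exists [:: (1, g)]; split; last by rewrite big_seq1 mul1r.
by move=> p; rewrite inE => /eqP ->.
Qed.

Lemma ideal_gen_min (R : comNzRingType) (G I : R -> Prop) :
  is_ideal I -> (forall g, G g -> I g) -> forall g, ideal_gen G g -> I g.
Proof.
move=> [I0 [ID IM]] GI g [s [Gs ->]]; rewrite big_seq.
by apply: big_ind => // p /Gs /GI; apply: IM.
Qed.

Lemma ideal_pow_ideal (R : comNzRingType) (I : R -> Prop) (t : nat) :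
  is_ideal (ideal_pow I t).
Proof. exact: ideal_gen_ideal. Qed.

Lemma ideal_pow1 (R : comNzRingType) (G : R -> Prop) (f : R) :
  ideal_pow (ideal_gen G) 1 f -> ideal_gen G f.
Proof.
apply: ideal_gen_min => [|g [[|a [|b s]] [sz [Ja ->]]] //].
  exact: ideal_gen_ideal.
by rewrite big_seq1; apply: Ja; rewrite inE.
Qed.

(** * Leading monomials for the weight *)

Definition low (K : fieldType) (m n d : nat) (p : {mpoly K[m * n]}) : Prop :=
  forall u, u \in msupp p -> (weight u < d)%N.

Lemma lowD (K : fieldType) (m n d : nat) (p q : {mpoly K[m * n]}) :
  low d p -> low d q -> low d (p + q).
Proof.
by move=> Hp Hq u /msuppD_le; rewrite mem_cat => /orP[/Hp|/Hq].
Qed.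

Lemma lowN (K : fieldType) (m n d : nat) (p : {mpoly K[m * n]}) :
  low d p -> low d (- p).
Proof. by move=> Hp u; rewrite (perm_mem (msuppN _)) => /Hp. Qed.

Lemma lowZ (K : fieldType) (m n d : nat) (c : K) (p : {mpoly K[m * n]}) :
  low d p -> low d (c *: p).
Proof. by move=> Hp u /msuppZ_le /Hp. Qed.

Lemma low_mulX (K : fieldType) (m n d : nat) (p : {mpoly K[m * n]}) (v : 'X_{1..m * n}) :
  low d p -> low (d + weight v) (p * 'X_[v]).
Proof.
move=> Hp u; rewrite (perm_mem (msuppMX _ _)) => /mapP[w /Hp wp ->].
by rewrite weightD addnC ltn_add2r.
Qed.

Lemma low_mul (K : fieldType) (m n d e : nat) (p q : {mpoly K[m * n]}) :
  low d p -> low e q -> low (d + e) (p * q).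
Proof.
move=> Hp Hq u /msuppM_le /allpairsP[[x y] /= [/Hp xp /Hq yq ->]].
by rewrite weightD -addSn leq_add // ltnW.
Qed.

Definition edge_minor (K : fieldType) (m n : nat) (v w : 'I_(m * n)) : {mpoly K[m * n]} :=
  'X_v * 'X_w -
  'X_(mxvec_index (row_of v) (col_of w)) * 'X_(mxvec_index (row_of w) (col_of v)).

Lemma edge_minor_JKP (K : fieldType) (m n : nat) (v w : 'I_(m * n)) :
  diag v w -> JKP K m n (edge_minor K v w).
Proof.
move=> /andP[lt_vw /eqP E]; apply: ideal_gen_sub.
exists (row_of v), (row_of w), (col_of v), (col_of w); split=> //; split=> //.
by rewrite /xvar /edge_minor !row_col_index.
Qed.

(** For rows [i < j] in adjacent columns, the diagonal term outweighs the other one by [j - i]. *)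
Lemma edge_minor_low (K : fieldType) (m n : nat) (v w : 'I_(m * n)) : diag v w ->
  low (weight (U_(v) + U_(w))%MM) (edge_minor K v w - 'X_[U_(v) + U_(w)]).
Proof.
move=> /andP[lt_vw /eqP E] u.
rewrite /edge_minor -!mpolyXD addrAC subrr add0r (perm_mem (msuppN _)) msuppX inE.
move=> /eqP ->; rewrite !weightD !weight1 !row_of_index !col_of_index E; nia.
Qed.

Lemma edges_reduce (K : fieldType) (m n : nat) (s : seq ('I_(m * n) * 'I_(m * n))) :
  all (fun p => diag p.1 p.2) s ->
  low (weight (\sum_(p <- s) (U_(p.1) + U_(p.2)))%MM)
    (\prod_(p <- s) edge_minor K p.1 p.2 - 'X_[(\sum_(p <- s) (U_(p.1) + U_(p.2)))%MM]).
Proof.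
elim: s => [|p s IH] /=; first by rewrite !big_nil mpolyX0 subrr => _ u; rewrite msupp0.
move=> /andP[dp /IH{}IH]; rewrite !big_cons.
set a := (U_(p.1) + U_(p.2))%MM; set b := (\sum_(_ <- _) _)%MM in IH *.
set g := edge_minor K _ _; set h := \prod_(_ <- _) _ in IH *.
have -> : g * h - 'X_[a + b] =
    (g - 'X_[a]) * (h - 'X_[b]) + (g - 'X_[a]) * 'X_[b] + (h - 'X_[b]) * 'X_[a].
  by rewrite mpolyXD; ring.
have Hg : low (weight a) (g - 'X_[a]) := edge_minor_low dp.
rewrite weightD; apply: lowD; last by rewrite addnC; apply: low_mulX.
by apply: lowD; [apply: low_mul | apply: low_mulX].
Qed.

Lemma packed_reduce (K : fieldType) (m n t : nat) (u : 'X_{1..m * n})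
    (s : seq ('I_(m * n) * 'I_(m * n))) :
  size s = t -> all (fun p => diag p.1 p.2) s ->
  (forall v, (\sum_(p <- s) ((v == p.1) + (v == p.2)) <= u v)%N) ->
  exists g, ideal_pow (JKP K m n) t g /\ low (weight u) (g - 'X_[u]).
Proof.
move=> sz ds le_s; set b := (\sum_(p <- s) (U_(p.1) + U_(p.2)))%MM.
have le_b : (b <= u)%MM.
  apply/mnm_lepP => v; rewrite mnm_sumE; apply: leq_trans (le_s v).
  by apply: leq_sum => p _; rewrite mnmDE !mnm1E ![v == _]eq_sym.
exists ('X_[u - b] * \prod_(p <- s) edge_minor K p.1 p.2); split.
  have [_ [_ IM]] := ideal_pow_ideal (JKP K m n) t.
  apply/IM/ideal_gen_sub; exists [seq edge_minor K p.1 p.2 | p <- s].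
  split; first by rewrite size_map.
  split; last by rewrite big_map.
  by move=> a /mapP[p ps ->]; apply: edge_minor_JKP; apply: (allP ds).
rewrite -{1 3}(submK le_b) weightD mpolyXD -mulrBr mulrC addnC.
by apply: low_mulX; apply: edges_reduce.
Qed.

(** * Membership in powers of the ideal through Taylor orders *)

Lemma ord_ge_pow (K : fieldType) (L N : nat) (c : 'I_N -> {mpoly K[L]})
    (I : {mpoly K[N]} -> Prop) (t : nat) :
  (forall a, I a -> ord_ge 1 (taylor c a)) ->
  forall f, ideal_pow I t f -> ord_ge t (taylor c f).
Proof.
move=> HI; apply: ideal_gen_min.
  split; first by move=> q _; rewrite taylor0 mcoeff0.
  split=> [a b Ha Hb|r a Ha]; first by rewrite taylorD; apply: ord_geD.
  by rewrite taylorM; apply: (ord_geM (s := 0) (ord_ge0 _) Ha).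
move=> _ [s [<- [Is ->]]]; elim: s Is => [|a s IH] Is; first exact: ord_ge0.
rewrite big_cons taylorM; apply: (@ord_geM _ _ 1).
  by apply/HI/Is; rewrite mem_head.
by apply: IH => b bs; apply: Is; rewrite inE bs orbT.
Qed.

Lemma ord_ge1 (R : comNzRingType) (n : nat) (p : {mpoly R[n]}) :
  ord_ge 1 p <-> p@_0%MM = 0.
Proof.
split=> [H|E q]; first by apply: H; rewrite mdeg0.
by rewrite ltnS leqn0 mdeg_eq0 => /eqP ->.
Qed.

Lemma taylor0M (K : fieldType) (L N : nat) (c : 'I_N -> {mpoly K[L]}) (f g : {mpoly K[N]}) :
  (taylor c (f * g))@_0%MM = (taylor c f)@_0%MM * (taylor c g)@_0%MM.
Proof. by rewrite taylorM; apply: (rmorphM (mcoeff 0%MM)). Qed.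

Lemma taylor0_det (K : fieldType) (L N : nat) (c : 'I_N -> {mpoly K[L]})
    (x y z w : {mpoly K[N]}) :
  (taylor c (x * y - z * w))@_0%MM =
  (taylor c x)@_0%MM * (taylor c y)@_0%MM - (taylor c z)@_0%MM * (taylor c w)@_0%MM.
Proof. by rewrite taylorB mcoeffB !taylor0M. Qed.

Lemma taylor0_xvar (K : fieldType) (m n : nat) (S : {set 'I_n}) (i : 'I_m) (k : 'I_n) :
  (taylor (rank_one K S) (xvar K m n i k))@_0%MM = rank_one K S (mxvec_index i k).
Proof. exact: taylor0X. Qed.

(** Within an interval the entries are [a_(c, i) * b_k], so both products have the same exponents; a
    column in [S] kills both. *)
Lemma taylor0_minor (K : fieldType) (m n : nat) (S : {set 'I_n}) (i j : 'I_m) (k l : 'I_n) :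
  k \in S \/ l \in S \/ comp_idx S k = comp_idx S l ->
  (taylor (rank_one K S) (xvar K m n i k * xvar K m n j l -
                          xvar K m n i l * xvar K m n j k))@_0%MM = 0.
Proof.
move=> H; rewrite taylor0_det 4!taylor0_xvar /rank_one 4!col_of_index.
case: ifP => [_|kS]; first by rewrite mul0r mulr0 subrr.
case: ifP => [_|lS]; first by rewrite mulr0 mul0r subrr.
case: H => [|[]]; rewrite ?kS ?lS // => E.
rewrite -!mpolyXD /param_monomial !row_of_index !col_of_index E.
apply/eqP; rewrite subr_eq0; apply/eqP; congr mpolyX.
by apply/mnmP => x; rewrite !mnmDE; lia.
Qed.

Lemma taylor0_JKP (K : fieldType) (m n : nat) (S : {set 'I_n}) (f : {mpoly K[m * n]}) :
  JKP K m n f -> ord_ge 1 (taylor (rank_one K S) f).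
Proof.
move=> Jf; apply/ord_ge1; move: f Jf; apply: ideal_gen_min.
  split; first by rewrite taylor0 mcoeff0.
  split=> [a b Ha Hb|r a Ha]; first by rewrite taylorD mcoeffD Ha Hb addr0.
  by rewrite taylor0M Ha mulr0.
move=> _ [i [j [k [l [_ [E ->]]]]]]; apply: taylor0_minor.
(* As [comp_idx] counts strictly smaller elements, it changes from [k] to the next column only if
   [k] is in [S]. *)
case kS: (k \in S); [by left | right; right].
apply/comp_idx_eqP; rewrite E // => s sS; rewrite leq_eqVlt => /predU1P[ks|//].
by rewrite -(val_inj ks) kS in sS.
Qed.

(* Descent on the weight: a monomial of top weight is the leading monomial of an
   element of [J^t], since otherwise a cover of weight less than [t] would
   exhibit its coefficient in some Taylor expansion below order [t]. *)
Lemma mem_pow_of_ord (K : fieldType) (m n t : nat) (f : {mpoly K[m * n]}) :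
  (0 < m)%N ->
  (forall S : {set 'I_n}, cut_set S -> ord_ge t (taylor (rank_one K S) f)) ->
  ideal_pow (JKP K m n) t f.
Proof.
move=> m_gt0; have [J0 [JD JM]] := ideal_pow_ideal (JKP K m n) t.
have [d] : exists d, low d f.
  exists (\max_(u <- msupp f) (weight u).+1) => u uf.
  by rewrite (big_rem u) //= leq_max leqnn.
elim: d f => [|d IH] f low_f ord_f.
  have -> : f = 0; last exact: J0.
  by apply/msuppnil0/nilP; rewrite /nilp -leqn0 leqNgt -has_predT; apply/hasPn => u /low_f.
(* [G] sums one correction per monomial of [f], zero for those already of weight below [d]. *)
have [G [JG low_G]] : exists G, ideal_pow (JKP K m n) t G /\ low d (f - G).
  have red u : u \in msupp f -> exists g,
      ideal_pow (JKP K m n) t g /\ low d (f@_u *: 'X_[u] - g).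
    move=> uf; case: (ltnP (weight u) d) => [ltd|led].
      exists 0; split; first exact: J0.
      by rewrite subr0 => w /msuppZ_le; rewrite msuppX inE => /eqP ->.
    have top p : p \in msupp f -> (weight p <= weight u)%N.
      by move=> /low_f; rewrite ltnS => /leq_trans; apply.
    have wu : weight u = d by apply/eqP; rewrite eqn_leq led -ltnS low_f.
    case: (packing_or_cover m_gt0 t u) => [[s [sz ds le_s]]|[C [S [cutS subC anti lt_t]]]].
      have [g [Jg low_g]] := packed_reduce K sz ds le_s.
      exists ((f@_u)%:MP * g); split; first exact: JM.
      by rewrite mul_mpolyC -scalerBr -wu -opprB; apply/lowZ/lowN.
    have := top_coef subC anti top uf; rewrite ord_f //.
      by rewrite mcoeff0 => /esym/eqP; rewrite mcoeff_eq0 uf.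
    rewrite mdegE; apply: leq_ltn_trans lt_t; rewrite [X in (_ <= X)%N]big_mkcond.
    by apply: leq_sum => v _; rewrite mnmE.
  suff [G [JG low_G]] : exists G, ideal_pow (JKP K m n) t G /\
      low d (\sum_(u <- msupp f) f@_u *: 'X_[u] - G).
    by exists G; split=> //; rewrite [f]mpolyE.
  have : {subset msupp f <= msupp f} by [].
  elim: {1 3}(msupp f) => [_|u r IHr sub].
    by exists 0; split; [exact: J0 | rewrite big_nil subr0 => w; rewrite msupp0].
  have [G [JG low_G]] : exists G, ideal_pow (JKP K m n) t G /\
      low d (\sum_(u <- r) f@_u *: 'X_[u] - G).
    by apply: IHr => w wr; apply: sub; rewrite inE wr orbT.
  have [g [Jg low_g]] := red u (sub u (mem_head _ _)).
  exists (g + G); split; first exact: JD.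
  by rewrite big_cons opprD addrACA; apply: lowD.
have -> : f = (f - G) + G by rewrite subrK.
apply: (JD) => //; apply: IH => // S cutS.
(* [G] has order at least [t] in every expansion, so the hypothesis survives the subtraction. *)
rewrite taylorB; apply: ord_geD; first exact: ord_f.
by apply/ord_geN/(ord_ge_pow _ JG) => a; apply: taylor0_JKP.
Qed.

(** * The associated primes *)

Definition cut_prime (K : fieldType) (m n : nat) (S : {set 'I_n})
    (f : {mpoly K[m * n]}) : Prop :=
  (taylor (rank_one K S) f)@_0%MM = 0.

Lemma cut_prime_prime (K : fieldType) (m n : nat) (S : {set 'I_n}) :
  is_prime_ideal (@cut_prime K m n S).
Proof.
rewrite /cut_prime; split; [split; [|split]|split].
- by rewrite taylor0 mcoeff0.
- by move=> a b Ha Hb; rewrite taylorD mcoeffD Ha Hb addr0.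
- by move=> r a Ha; rewrite taylor0M Ha mulr0.
- by rewrite taylor1 mcoeff1 eqxx; apply/eqP/oner_neq0.
- move=> a b; rewrite taylor0M => /eqP; rewrite mulf_eq0.
  by case/orP=> /eqP; [left | right].
Qed.

Lemma cut_prime_Ass (K : fieldType) (m n : nat) (S : {set 'I_n}) :
  (1 < m)%N -> cut_set S -> Ass (JKP K m n) (@cut_prime K m n S).
Proof.
move=> m_gt1 cutS; split; first exact: cut_prime_prime.
have m_gt0 : (0 < m)%N by apply: ltnW.
pose r0 := Ordinal m_gt0; pose r1 := Ordinal m_gt1.
pose minor (k l : 'I_n) : {mpoly K[m * n]} :=
  xvar K m n r0 k * xvar K m n r1 l - xvar K m n r0 l * xvar K m n r1 k.
(* [g] lies in every other [cut_prime]: in that of [S'] it has a factor [x_(0,k)]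
   with [k] in [S'] if [S'] is not included in [S], and otherwise the minor
   of the columns around any [k] in [S :\: S']. *)
pose gap (k : 'I_n) : {mpoly K[m * n]} := 
    \prod_(k1 : 'I_n | k == k1.+1 :> nat) \prod_(k2 : 'I_n | k2 == k.+1 :> nat) minor k1 k2.
pose g := (\prod_(k | k \notin S) xvar K m n r0 k) * \prod_(k in S) gap k.
have prodE (I : finType) (P : pred I) (F : I -> {mpoly K[m * n]}) S' :
  (taylor (rank_one K S') (\prod_(i | P i) F i))@_0%MM =
  \prod_(i | P i) (taylor (rank_one K S') (F i))@_0%MM.
  apply: (big_morph (fun f => (taylor (rank_one K S') f)@_0%MM)) => [x y|].
    exact: taylor0M.
  by rewrite taylor1 mcoeff1 eqxx.
have comp_jump k k1 k2 : k \in S -> k = k1.+1 :> nat -> k2 = k.+1 :> nat ->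
    comp_idx S k1 != comp_idx S k2.
  move=> kS kk1 k2k; have k12 : (k1 <= k2)%N by rewrite k2k kk1 -addn2 leq_addr.
  apply/eqP => /(comp_idx_eqP _ k12) /(_ k kS).
  by rewrite kk1 leqnSn k2k kk1 ltnn => /(_ isT).
have gS : (taylor (rank_one K S) g)@_0%MM != 0.
  rewrite taylor0M !prodE mulf_neq0 //; apply/prodf_neq0 => k kS.
    by rewrite taylor0_xvar /rank_one col_of_index (negbTE kS) -msupp_eq0 msuppX.
  rewrite /gap prodE; apply/prodf_neq0 => k1 /eqP kk1.
  rewrite prodE; apply/prodf_neq0 => k2 /eqP k2k.
  have [[l1 l1S E1] [l2 l2S E2]] := cutS k kS.
  have k1S : k1 \notin S.
    by have -> : k1 = l1 by apply: val_inj; apply: succn_inj; rewrite -kk1 -E1.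
  have k2S : k2 \notin S by have -> : k2 = l2 by apply: val_inj; rewrite /= k2k E2.
  rewrite taylor0_det 4!taylor0_xvar /rank_one 4!col_of_index.
  rewrite (negbTE k1S) (negbTE k2S) -!mpolyXD subr_eq0.
  apply: contra (comp_jump k k1 k2 kS kk1 k2k) => /eqP/mpolyX_inj.
  (* The [a] variable of row [r0] on the interval of [k1] occurs in the first product, and in the
     second only if [k2] is in the same interval. *)
  move/mnmP/(_ (enum_rank (inl (inord (comp_idx S k1), r0)))).
  rewrite !mnmDE !mnm1E !(inj_eq enum_rank_inj) !row_of_index !col_of_index.
  have inlE (x y : 'I_n.+1 * 'I_m) :
    (inl x == inl y :> ('I_n.+1 * 'I_m) + 'I_n) = (x == y) by [].
  rewrite !inlE !xpair_eqE !eqxx /= !andbF /= !andbT !addn0.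
  case: (@eqP 'I_n.+1 (inord _) (inord _)) => // /(congr1 (@nat_of_ord n.+1)).
  by rewrite !inordK ?comp_idx_le // => ->.
have gS' S' : cut_set S' -> S' != S -> (taylor (rank_one K S') g)@_0%MM = 0.
  move=> cutS' neq; rewrite taylor0M !prodE.
  case: (boolP (S' \subset S)) => [sub|/subsetPn[k kS' kS]].
    have /subsetPn[k kS kS'] : ~~ (S \subset S').
      by apply: contra neq => sub'; rewrite eqEsubset sub.
    have [[l1 l1S E1] [l2 l2S E2]] := cutS k kS.
    rewrite [X in _ * X](bigD1 k) //=.
    suff -> : (taylor (rank_one K S') (gap k))@_0%MM = 0 by rewrite mul0r mulr0.
    rewrite /gap prodE (bigD1 l1) ?E1 //= prodE (bigD1 l2) -?E1 ?E2 //=.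
    rewrite taylor0_minor ?mul0r //.
    (* Neither [l1] nor [k] is in [S'], so [S'] does not separate [l1] from [l2]. *)
    right; right; apply/comp_idx_eqP; first by rewrite E2 E1 -addn2 leq_addr.
    move=> s sS' l1s; rewrite E2 ltn_neqAle E1 ltn_neqAle l1s andbT -E1.
    apply/andP; split; first by apply: contraNneq kS' => /val_inj ->.
    by apply: contraNneq l1S => /val_inj ->; apply: (subsetP sub).
  by rewrite (bigD1 k) //= taylor0_xvar /rank_one col_of_index kS' !mul0r.
exists g => f; rewrite /colon /cut_prime; split=> [fS|Jfg].
  (* [f * g] lies in every cut prime, so the membership criterion applies with [t = 1]. *)
  apply: ideal_pow1; apply: mem_pow_of_ord => // S' cutS'.
  apply/ord_ge1; rewrite taylor0M.
  by case: (eqVneq S' S) => [->|neq]; [rewrite fS mul0r | rewrite gS' // mulr0].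
have /ord_ge1 := taylor0_JKP S Jfg; rewrite taylor0M => /eqP.
by rewrite mulf_eq0 (negbTE gS) orbF => /eqP.
Qed.

Theorem theorem3p13 (K : fieldType) (m n : nat) (hm : (2 <= m)%N) (hn : (2 <= n)%N)
  (t : nat) (ht : (0 < t)%N) :
  forall f : {mpoly K[m * n]},
    symbolic_pow (JKP K m n) t f <-> ideal_pow (JKP K m n) t f.
Proof.
move=> f; split=> [symb|Jf P [[_ [P1 _]] _]]; last by exists 1; rewrite mul1r.
apply: mem_pow_of_ord => [|S cutS]; first exact: ltnW.
have [s [Ps Jsf]] := symb _ (cut_prime_Ass K hm cutS).
(* [s] lies outside the cut prime, so its expansion has a nonzero constant term and can be
   cancelled. *)
apply: (@ord_ge_cancel _ _ _ (taylor (rank_one K S) s)); first by apply/eqP.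
rewrite -taylorM; apply: ord_ge_pow Jsf => a; exact: taylor0_JKP.
Qed.
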